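(* Let $\epsilon,\delta\in\{1,i\}$. Let $(M,g)$ be a pseudo-Riemannian surface with isothermal coordinates $(x,y)$ in which $g=e^{f(x,y)}(dx^2-\epsilon^2dy^2)$, and let $(N,h)$ be a pseudo-Riemannian surface with coordinates $(R,S)$ in which $h=A(R)\,dR^2-\delta^2B(R)\,dS^2$, where $A,B$ are smooth positive functions. Let $a,b,\kappa,\lambda\in\mathbb{R}$ be constants with $b^2\neq\epsilon^2a^2$ and $ab\neq0$, and set $t=ay-bx$. Let $R(t)$ and $H(t)$ be smooth real-valued functions on an open interval, with $R(t)$ taking values in the domain of $A$ and $B$ and $R'(t)\neq 0$ on this interval, satisfying $$H'(t)=\frac{2\lambda\delta^2(b^2+\epsilon^2a^2)+4\kappa\delta^2ab+ab(a^2+b^2)(\epsilon^2+1)B(R)}{(b^2-\epsilon^2a^2)(a^2+b^2)B(R)}$$ and $$R'(t)^2=\frac{c_1B(R)^2+c_2\kappa\,B(R)+c_3\lambda\,B(R)+c_4}{(a^2+b^2)^2(b^2-\epsilon^2a^2)^2A(R)B(R)},$$ where $$c_1=\delta^2\epsilon^2(a^2+b^2)^4,\qquad c_2=4(a^2+b^2)^2(b^2+\epsilon^2a^2),$$ $$c_3=8\epsilon^2ab(a^2+b^2)^2,\qquad c_4=4\delta^2\bigl(2\kappa ab+\lambda(b^2+\epsilon^2a^2)\bigr)^2.$$ Then the map $u=(R,S):(M,g)\to(N,h)$ given by $$R(x,y)=R(ay-bx),\qquad S(x,y)=ax+by+H(ay-bx),$$ defined at the points of $M$ for which $t=ay-bx$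 lies in the given interval, is a harmonic, respectively wave, map.
   Context: The surface metric $g=e^{f}(dx^2-\epsilon^2dy^2)$, with $f$ a smooth real function, is Lorentzian if $\epsilon=1$ and Riemannian if $\epsilon=i$; likewise the target metric $h=A(R)dR^2-\delta^2B(R)dS^2$ is Lorentzian if $\delta=1$ and Riemannian if $\delta=i$. Put $v=x+\epsilon y$, $w=x-\epsilon y$, and for a function $\phi$ of $(x,y)$ let $\phi_v=\tfrac12(\phi_x+\tfrac1\epsilon\phi_y)$, $\phi_w=\tfrac12(\phi_x-\tfrac1\epsilon\phi_y)$. The energy of a smooth map $u=(R,S)$ is, up to a positive constant factor which plays no role, $$E(u)=\int\bigl(A(R)R_vR_w-\delta^2B(R)S_vS_w\bigr)\,dx\,dy .$$ The map $u$ is called harmonic if it is a critical point of $E$ (with respect to smooth compactly supported variations of $(R,S)$). When the domain is Lorentzian, a harmonic map is called a wave map. *)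

(* Defs.v *)
From HB Require Import structures.
From mathcomp Require Import all_boot all_order all_algebra.
From mathcomp Require Export complex.
From mathcomp Require Import all_classical all_reals all_analysis.
Set Implicit Arguments.
Unset Strict Implicit.
Unset Printing Implicit Defensive.

Import Order.TTheory GRing.Theory Num.Theory.
Import numFieldNormedType.Exports.

Local Open Scope classical_set_scope.
Local Open Scope ring_scope.
Local Open Scope complex_scope.

Section Smoothness.
Context {R : realType}.
Implicit Types (I : set R) (U : set (R * R)).

Definition smooth1 I (f : R -> R) :=
  forall (n : nat) (t : R), I t -> derivable (derive1n n f) t 1.

Definition partial_x (f : R * R -> R) (p : R * R) : R := 'D_((1, 0) : R * R) f p.
Definition partial_y (f : R * R -> R) (p : R * R) : R := 'D_((0, 1) : R * R) f p.

Fixpoint Ck (k : nat) U (f : R * R -> R) : Prop :=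
  (forall p, U p -> {for p, continuous f}) /\
  (if k is k'.+1 then
     [/\ forall p, U p -> derivable f p (1, 0) /\ derivable f p (0, 1),
         Ck k' U (partial_x f) & Ck k' U (partial_y f)]
   else True).

Definition smooth2 U (f : R * R -> R) := forall k, Ck k U f.

Definition smooth_map U (u : R * R -> R * R) :=
  smooth2 U (fun p => (u p).1) /\ smooth2 U (fun p => (u p).2).

End Smoothness.

Section Energy.
Context {R : realType}.
Implicit Types (eps delta : R[i]) (A B : R -> R) (u eta : R * R -> R * R).
Implicit Types (J : set R) (U K : set (R * R)).

Definition diff_v eps (f : R * R -> R) (p : R * R) : R[i] :=
  2^-1 * ((partial_x f p)%:C + eps^-1 * (partial_y f p)%:C).

Definition diff_w eps (f : R * R -> R) (p : R * R) : R[i] :=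
  2^-1 * ((partial_x f p)%:C - eps^-1 * (partial_y f p)%:C).

(* With respect to dx dy: the conformal factor of e^f (dx^2 - eps^2 dy^2)
   cancels between the area form and the inverse metric. *)
Definition energy_density eps delta A B u (p : R * R) : R[i] :=
  let u1 := fun q => (u q).1 in
  let u2 := fun q => (u q).2 in
  (A (u1 p))%:C * diff_v eps u1 p * diff_w eps u1 p
  - delta ^+ 2 * (B (u1 p))%:C * diff_v eps u2 p * diff_w eps u2 p.

(* The density is real for eps, delta in {1, i} (energy_density_real below), so
   taking real parts loses nothing. *)
Definition energy eps delta A B u K : R :=
  Rintegral (lebesgue_measure \x lebesgue_measure)%E K
    (fun p : measurableTypeR R * measurableTypeR R =>
       complex.Re (energy_density eps delta A B u p)).

(* eta is the extension by zero of a smooth field with compact support in U. *)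
Definition compactly_supported_variation U eta :=
  [/\ smooth_map setT eta,
      compact (closure [set p | eta p != 0]) &
      closure [set p | eta p != 0] `<=` U].

(* The energy over U may diverge, so it is taken over the compact subsets of U
   that contain the support of the variation. *)
Definition critical_point eps delta A B U u :=
  forall eta K, compactly_supported_variation U eta ->
    compact K -> K `<=` U -> closure [set p | eta p != 0] `<=` K ->
    is_derive (0 : R) 1
      (fun s : R => energy eps delta A B (fun p => u p + s *: eta p) K) 0.

(* Harmonicity of u : U -> J x R, where the target carries the metric
   A(R) dR^2 - delta^2 B(R) dS^2 and J is the domain of A and B. *)
Definition harmonic_map eps delta J A B U u :=
  [/\ smooth_map U u,
      forall p, U p -> J (u p).1 &
      critical_point eps delta A B U u].

Definition wave_map eps delta J A B U u :=
  eps = 1 /\ harmonic_map eps delta J A B U u.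

Lemma energy_density_real eps delta A B u p :
  eps = 1 \/ eps = 'i -> delta = 1 \/ delta = 'i ->
  complex.Im (energy_density eps delta A B u p) = 0.
Proof.
have sqE (z : R[i]) : z = 1 \/ z = 'i ->
    exists r : R, z ^+ 2 = r%:C /\ z^-1 ^+ 2 = r%:C.
  case=> ->; first by exists 1; rewrite invr1 expr1n.
  by exists (-1); rewrite exprVn sqr_i invrN1 rmorphN rmorph1.
have prodE (z e : R[i]) (r : R) f q : e^-1 ^+ 2 = r%:C ->
    z * diff_v e f q * diff_w e f q =
    z * (4^-1 * (partial_x f q ^+ 2 - r * partial_y f q ^+ 2))%:C.
  move=> er; rewrite -(mulrA z); congr (_ * _).
  rewrite /diff_v /diff_w mulrACA (mulrC (_ + _)) -subr_sqr exprMn er.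
  have -> : 2^-1 * 2^-1 = (4^-1 : R)%:C.
    by rewrite -invfM -natrM fmorphV rmorph_nat.
  by rewrite -!rmorphXn -rmorphM -rmorphB -rmorphM.
move=> /sqE[e [_ eE]] /sqE[d [dE _]].
suff [x ->] : exists x : R, energy_density eps delta A B u p = x%:C by [].
rewrite /energy_density; lazy zeta; rewrite !(prodE _ _ _ _ _ eE) dE.
by rewrite -!rmorphM -rmorphB; eexists.
Qed.

End Energy.

(* Main.v *)
Require Import Defs.
From HB Require Import structures.
From mathcomp Require Import all_boot all_order all_algebra.
From mathcomp Require Import all_classical all_reals all_analysis.
From mathcomp Require Import measurable_realfun ring.
Import Order.TTheory GRing.Theory Num.Theory.
Import numFieldNormedType.Exports.

(** Write e = eps^2 and d = delta^2, both 1 or -1, and t = a y - b x. In real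
    form the energy density of u = (r, s) is
      1/4 (A(r) (r_x^2 - e r_y^2) - d B(r) (s_x^2 - e s_y^2)),
    which is [Re_energy_density]. The map of the theorem depends on (x, y)
    through t only, up to the linear term a x + b y of s, so its Euler-Lagrange
    equations are ordinary differential equations in t. With D = b^2 - e a^2
    they read
      (B(r) (D H' - a b (1 + e)))' = 0,
      D (A'(r) r'^2 + 2 A(r) r'') = - d B'(r) ((a - b H')^2 - e (b + a H')^2).

    The formula for H' says that the bracketed quantity of the first equation is
    constant; differentiating it gives [profile_S_equation]. The formula for
    r'^2 is an energy integral of the second equation: multiplied out it
    expresses A(r) B(r) r'^2 as a quadratic polynomial in B(r), and
    differentiating it, dividing by r' and eliminating r'^2 gives the second
    equation ([profile_R_equation]). The last step of this elimination is the
    identity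
      e (a^2 + b^2)^2 = a^2 b^2 (1 + e)^2 - (a^2 - e b^2) (b^2 - e a^2)
    for e^2 = 1.

    Criticality is the first variation formula. Let K be a compact set that
    contains the support of the variation (h, k). Over K the
    energy can be differentiated inside the integral
    ([is_derive_Rintegral_lagrangian]). Once the two equations hold, the
    resulting integrand is the divergence of the fields obtained by multiplying
    the momenta A(r) r', B(r) (a - b H') and B(r) (b + a H') by h and k. These
    products vanish outside K, hence extend by zero to the plane, where the
    integral of a partial derivative of a compactly supported function is zero
    by Fubini and the fundamental theorem of calculus
    ([Rintegral_partial_x0], [Rintegral_partial_y0]). *)

Set Implicit Arguments.
Unset Strict Implicit.
Unset Printing Implicit Defensive.

Local Open Scope classical_set_scope.
Local Open Scope ring_scope.
Local Open Scope complex_scope.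

Local Notation plane R := (measurableTypeR R * measurableTypeR R)%type.
Local Notation mu2 := (lebesgue_measure \x lebesgue_measure)%E.

(** * Continuous functions on compact subsets of the plane *)

Section PlaneMeasure.
Context {R : realType}.
Local Notation mu := (@lebesgue_measure R).

(** An open set of the plane is a countable union of products of balls with
    rational centres and radii 1/(n+1). *)
Lemma open_measurable_plane (U : set (R * R)) :
  open U -> measurable (U : set (plane R)).
Proof.
move=> oU.
pose F (i : rat * rat * nat) : set (plane R) :=
  if `[< ball (ratr i.1.1 : R) i.2.+1%:R^-1 `*` ball (ratr i.1.2 : R) i.2.+1%:R^-1
        `<=` U >]
  then ball (ratr i.1.1 : R) i.2.+1%:R^-1 `*` ball (ratr i.1.2 : R) i.2.+1%:R^-1
  else set0.
have -> : U = \bigcup_i F i.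
  apply/seteqP; split => [p Up|p [i _]]; last first.
    by rewrite /F; case: asboolP => [sub /sub|_ []].
  have /nbhs_ballP[e /= e0 eU] : nbhs p U by exact: open_nbhs_nbhs.
  have [n ne] : exists n : nat, n.+1%:R^-1 < e / 2.
    have e20 : 0 < e / 2 by rewrite divr_gt0.
    near \oo => n; exists n; near: n.
    exact: (near_infty_natSinv_lt (PosNum e20)).
  have n0 : 0 < n.+1%:R^-1 :> R by rewrite invr_gt0 ltr0n.
  have dr (x : R) : exists q : rat, `|ratr q - x| < n.+1%:R^-1.
    have xn : x - n.+1%:R^-1 < x + n.+1%:R^-1.
      by rewrite ltrBlDr -addrA ltrDl addr_gt0.
    have [q] := rat_in_itvoo xn.
    by rewrite in_itv/= => qx; exists q; rewrite ltr_distl.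
  have [[q1 q1p] [q2 q2p]] := (dr p.1, dr p.2).
  exists (q1, q2, n) => //; rewrite /F /=.
  have sub : ball (ratr q1 : R) n.+1%:R^-1 `*` ball (ratr q2 : R) n.+1%:R^-1 `<=` U.
    move=> z [/= z1 z2]; apply: eU; split => /=.
      rewrite /ball/= in z1 *; rewrite (le_lt_trans (ler_distD (ratr q1) _ _))//.
      by rewrite [e]splitr ltrD// (lt_trans _ ne)// distrC.
    rewrite /ball/= in z2 *; rewrite (le_lt_trans (ler_distD (ratr q2) _ _))//.
    by rewrite [e]splitr ltrD// (lt_trans _ ne)// distrC.
  by case: asboolP.
apply: countable_bigcupT_measurable => [|i]; first exact: countableP.
rewrite /F; case: asboolP => // _.
by apply: measurableX; rewrite ball_itv; exact: measurable_itv.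
Unshelve. all: end_near. Qed.

Lemma compact_measurable_plane (K : set (R * R)) :
  compact K -> measurable (K : set (plane R)).
Proof.
move=> /compact_closed => /(_ (@norm_hausdorff _ _)) cK.
rewrite -(setCK K); apply: measurableC; apply: open_measurable_plane.
exact: closed_openC.
Qed.

Lemma compact_plane_sub_square (K : set (R * R)) : compact K ->
  exists2 m : R, 0 < m & K `<=` [set p | `|p.1| < m /\ `|p.2| < m].
Proof.
move=> /compact_bounded[M [_ MK]].
exists (`|M| + 2) => [|p Kp]; first by rewrite ltr_wpDl.
have pM : `|p| <= `|M| + 1 by apply: MK => //; rewrite (le_lt_trans (ler_norm M))// ltrDl.
by move: pM; rewrite prod_normE ge_max => /andP[p1 p2]; split;
  rewrite (le_lt_trans p1, le_lt_trans p2)// ltrD2l ltr1n.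
Qed.

Lemma compact_finite_plane (K : set (R * R)) :
  compact K -> (mu2 (K : set (plane R)) < +oo)%E.
Proof.
move=> cK; have [m m0 Km] := compact_plane_sub_square cK.
apply: (@le_lt_trans _ _ (mu2 (`[- m, m] `*` `[- m, m] : set (plane R)))).
  apply: le_measure; rewrite ?inE; first exact: compact_measurable_plane.
    by apply: measurableX; exact: measurable_itv.
  by move=> p /Km[/ltW + /ltW]; rewrite !ler_norml /= !in_itv.
rewrite product_measure1E; try exact: measurable_itv.
have mfin : (mu `[(- m)%R, m] < +oo)%E.
  by rewrite lebesgue_measure_itv/=; case: ifP => _; rewrite // -EFinB ltry.
by apply: lte_mul_pinfty => //; rewrite ge0_fin_numE.
Qed.

Lemma continuous_compact_integrable_plane (f : R * R -> R) (K : set (R * R)) :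
  compact K -> {within K, continuous f} ->
  mu2.-integrable (K : set (plane R)) (EFin \o f).
Proof.
move=> cK cf; apply: measurable_bounded_integrable.
- exact: compact_measurable_plane.
- exact: compact_finite_plane.
- apply: (measurability _ (RGenOpens.measurableE R)).
  move=> _ [_ [x [y ->] <-]].
  have /open_subspaceP[V oV VK] : open (f @^-1` `]x, y[ : set (subspace K)).
    by move/continuousP: cf; apply; exact: interval_open.
  rewrite setIC -VK; apply: measurableI; first exact: open_measurable_plane.
  exact: compact_measurable_plane.
- have /compact_bounded[M [_ mrt]] := continuous_compact cf cK.
  by exists M; split; rewrite ?num_real // => ? ? ? ?; exact: mrt.
Qed.

(** The fundamental theorem of calculus on [-m, m]: the boundary values
    vanish. *)
Lemma integral_derivative_compact_support (f df : R -> R) (m : R) : 0 < m ->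
  (forall x, is_derive x (1:R) f (df x)) -> continuous df ->
  (forall x, m <= `|x| -> f x = 0) -> (forall x, m <= `|x| -> df x = 0) ->
  (\int[mu]_x (df x)%:E = 0)%E.
Proof.
move=> m0 fdf cdf f0 df0.
have cf : continuous f.
  by move=> x; apply/differentiable_continuous/derivable1_diffP; apply: ex_derive.
have -> : (fun x => (df x)%:E) = (fun x => (df x)%:E) \_ `[- m, m].
  apply/funext => x; rewrite patchE; case: ifPn => //.
  rewrite notin_setE/= in_itv/= -ler_norml => /negP; rewrite -ltNge => /ltW.
  by move/df0 ->.
rewrite -integral_mkcond (@continuous_FTC2 _ df f).
- by rewrite !f0 ?normrN ?ger0_norm// ?ltW// subee.
- by rewrite -subr_gt0 opprK addr_gt0.
- exact: continuous_subspaceT.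
- by split=> [x _||]; [apply: ex_derive | apply: cvg_at_right_filter; exact: cf
    | apply: cvg_at_left_filter; exact: cf].
- by move=> x _; rewrite derive1E; apply: derive_val.
Qed.

End PlaneMeasure.

(** * Partial derivatives of compactly supported functions *)

Lemma continuous_pair (T U V : topologicalType) (f : T -> U) (g : T -> V) (x : T) :
  {for x, continuous f} -> {for x, continuous g} ->
  {for x, continuous (fun z => (f z, g z))}.
Proof. exact: cvg_pair. Qed.

Section PartialDerivatives.
Context {R : realType}.

Lemma is_derive_xP (f : R * R -> R) (x y d : R) :
  is_derive (x, y) (1, 0) f d <-> is_derive x 1 (fun s => f (s, y)) d.
Proof.
have E : (fun h : R => h^-1 *: (f (h *: (1, 0) + (x, y)) - f (x, y))) =
         (fun h : R => h^-1 *: (f (h *: 1 + x, y) - f (x, y))).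
  apply/funext => h; congr (_ *: (f _ - _)).
  by congr pair; rewrite /= scaler0 add0r.
split=> -[df fd].
- by split; [rewrite /derivable -E | rewrite /derive -E].
- by split; [rewrite /derivable E | rewrite /derive E].
Qed.

Lemma is_derive_yP (f : R * R -> R) (x y d : R) :
  is_derive (x, y) (0, 1) f d <-> is_derive y 1 (fun s => f (x, s)) d.
Proof.
have E : (fun h : R => h^-1 *: (f (h *: (0, 1) + (x, y)) - f (x, y))) =
         (fun h : R => h^-1 *: (f (x, h *: 1 + y) - f (x, y))).
  apply/funext => h; congr (_ *: (f _ - _)).
  by congr pair; rewrite /= scaler0 add0r.
split=> -[df fd].
- by split; [rewrite /derivable -E | rewrite /derive -E].
- by split; [rewrite /derivable E | rewrite /derive E].
Qed.

Lemma is_derive_vanish_off_closed (V : normedModType R) (K : set V) (f : V -> R) (p v : V) (d : R) :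
  closed K -> (forall q, ~ K q -> f q = 0) -> ~ K p -> is_derive p v f d -> d = 0.
Proof.
move=> cK fK Kp df.
rewrite -(@derive_val _ _ _ _ _ _ _ df).
rewrite (@near_eq_derive _ _ _ f (cst 0) p v) ?derive_cst//.
have : nbhs p (~` K) by apply: open_nbhs_nbhs; split => //; exact: closed_openC.
by apply: filterS => q /fK.
Qed.

(** The integral over a compact set carrying the support is an integral over
    the whole plane, to which Fubini applies. *)
Lemma Rintegral_compact_support (f : R * R -> R) (K : set (R * R)) :
  compact K -> continuous f -> (forall p, ~ K p -> f p = 0) ->
  mu2.-integrable setT (EFin \o f : plane R -> _) /\
  Rintegral mu2 (K : set (plane R)) f = fine (\int[mu2]_p ((f p)%:E)).
Proof.
move=> cK cf fK.
have fE : (fun p => (f p)%:E) = (EFin \o f) \_ K.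
  apply/funext => p; rewrite patchE; case: ifPn => //.
  by rewrite notin_setE => /fK ->.
have mK := compact_measurable_plane cK.
split.
  rewrite [X in integrable _ _ X]fE; apply/(integrable_mkcond _ mK).
  by apply: continuous_compact_integrable_plane => //; exact: continuous_subspaceT.
by rewrite /Rintegral [in RHS]fE -integral_mkcond.
Qed.

(** Fubini, integrating along the differentiated variable first: every inner
    integral vanishes. *)
Lemma Rintegral_partial_x0 (f df : R * R -> R) (K : set (R * R)) :
  compact K -> (forall p : R * R, is_derive p ((1, 0) : R * R) f (df p)) -> continuous df ->
  (forall p, ~ K p -> f p = 0) ->
  Rintegral mu2 (K : set (plane R)) df = 0.
Proof.
move=> cK fdf cdf fK.
have clK : closed K by apply: compact_closed => //; exact: norm_hausdorff.
have dfK p : ~ K p -> df p = 0.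
  by move=> Kp; apply: (is_derive_vanish_off_closed clK fK Kp (fdf p)).
have [intdf ->] := Rintegral_compact_support cK cdf dfK.
have [m m0 Km] := compact_plane_sub_square cK.
rewrite -(integral21_prod_meas1 intdf) /=.
rewrite (eq_integral (cst 0%E)) ?integral0// => y _.
apply: (@integral_derivative_compact_support _ (fun x => f (x, y)) _ m m0).
- by move=> x; apply/is_derive_xP.
- move=> x; apply: (@continuous_comp _ _ _ (fun x => (x, y)) df); last exact: cdf.
  by apply: continuous_pair; [exact: cvg_id|exact: cvg_cst].
- by move=> x mx; apply: fK => /Km[/=]; rewrite ltNge mx.
- by move=> x mx; apply: dfK => /Km[/=]; rewrite ltNge mx.
Qed.

Lemma Rintegral_partial_y0 (f df : R * R -> R) (K : set (R * R)) :
  compact K -> (forall p : R * R, is_derive p ((0, 1) : R * R) f (df p)) -> continuous df ->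
  (forall p, ~ K p -> f p = 0) ->
  Rintegral mu2 (K : set (plane R)) df = 0.
Proof.
move=> cK fdf cdf fK.
have clK : closed K by apply: compact_closed => //; exact: norm_hausdorff.
have dfK p : ~ K p -> df p = 0.
  by move=> Kp; apply: (is_derive_vanish_off_closed clK fK Kp (fdf p)).
have [intdf ->] := Rintegral_compact_support cK cdf dfK.
have [m m0 Km] := compact_plane_sub_square cK.
rewrite -(integral12_prod_meas1 intdf) /=.
rewrite (eq_integral (cst 0%E)) ?integral0// => x _.
apply: (@integral_derivative_compact_support _ (fun y => f (x, y)) _ m m0).
- by move=> y; apply/is_derive_yP.
- move=> y; apply: (@continuous_comp _ _ _ (fun y => (x, y)) df); last exact: cdf.
  by apply: continuous_pair; [exact: cvg_cst|exact: cvg_id].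
- by move=> y my; apply: fK => /Km[/= _]; rewrite ltNge my.
- by move=> y my; apply: dfK => /Km[/= _]; rewrite ltNge my.
Qed.

End PartialDerivatives.

(** * Calculus of functions of the phase *)

Section PointwiseRules.
Context {R : realType} {V : normedModType R}.
Implicit Types (f g : V -> R) (x v : V).

(** A copy of [is_derive] outside the class mechanism: on a goal with unknown
    derivative, instance search would choose its own form of the value. *)
Definition has_derive x v f (d : R) : Prop := is_derive x v f d.

Lemma has_derive_eq f x v d d' : has_derive x v f d -> d = d' -> is_derive x v f d'.
Proof. by move=> fd <-. Qed.

Lemma has_derive_add f g x v df dg : has_derive x v f df -> has_derive x v g dg ->
  has_derive x v (fun y => f y + g y) (df + dg).
Proof. by move=> fd gd; exact: is_deriveD. Qed.

Lemma has_derive_sub f g x v df dg : has_derive x v f df -> has_derive x v g dg ->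
  has_derive x v (fun y => f y - g y) (df - dg).
Proof. by move=> fd gd; exact: is_deriveB. Qed.

Lemma has_derive_mul f g x v df dg : has_derive x v f df -> has_derive x v g dg ->
  has_derive x v (fun y => f y * g y) (f x * dg + g x * df).
Proof. by move=> fd gd; exact: is_deriveM. Qed.

Lemma has_derive_cst (k : R) x v : has_derive x v (fun=> k) 0.
Proof. exact: is_derive_cst. Qed.

End PointwiseRules.

Section PointwiseContinuity.
Context {R : realType} {T : topologicalType}.
Implicit Types (f g : T -> R) (x : T).

Lemma continuous_addf f g x : {for x, continuous f} -> {for x, continuous g} ->
  {for x, continuous (fun y => f y + g y)}.
Proof. exact: cvgD. Qed.

Lemma continuous_subf f g x : {for x, continuous f} -> {for x, continuous g} ->
  {for x, continuous (fun y => f y - g y)}.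
Proof. exact: cvgB. Qed.

Lemma continuous_mulf f g x : {for x, continuous f} -> {for x, continuous g} ->
  {for x, continuous (fun y => f y * g y)}.
Proof. exact: cvgM. Qed.

Lemma continuous_cstf (k : R) x : {for x, continuous (fun=> k)}.
Proof. exact: cvg_cst. Qed.

Lemma continuous_compf (h : R -> R) f x : {for x, continuous f} ->
  {for f x, continuous h} -> {for x, continuous (fun y => h (f y))}.
Proof. exact: continuous_comp. Qed.

End PointwiseContinuity.

(* The function is split along its head symbol, read off the goal: trying the
   rules blindly makes unification unfold the topological structures. *)
Tactic Notation "continuity_by" tactic3(leaf) :=
  repeat lazymatch goal with
  | |- {for _, continuous (fun=> ?k)} => exact: continuous_cstf
  | |- {for _, continuous (fun x => @?f x - @?g x)} => apply: (@continuous_subf _ _ f g)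
  | |- {for _, continuous (fun x => @?f x + @?g x)} => apply: (@continuous_addf _ _ f g)
  | |- {for _, continuous (fun x => @?f x * @?g x)} => apply: (@continuous_mulf _ _ f g)
  | |- {for _, continuous _} => leaf
  end.

Tactic Notation "derivative_by" tactic3(leaf) :=
  repeat lazymatch goal with
  | |- has_derive _ _ (fun=> ?k) _ => exact: has_derive_cst
  | |- has_derive _ _ (fun x => @?f x - @?g x) _ => apply: (@has_derive_sub _ _ f g)
  | |- has_derive _ _ (fun x => @?f x + @?g x) _ => apply: (@has_derive_add _ _ f g)
  | |- has_derive _ _ (fun x => @?f x * @?g x) _ => apply: (@has_derive_mul _ _ f g)
  | |- has_derive _ _ _ _ => leaf
  end.

Section Phase.
Context {R : realType} (a b : R).

(** The variable t on which the coefficients of the variational problem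
    depend. *)
Definition phase (p : R * R) : R := a * p.2 - b * p.1.

Lemma continuous_proj1 (p : R * R) : {for p, continuous (fun q : R * R => q.1)}.
Proof. exact: cvg_fst. Qed.

Lemma continuous_proj2 (p : R * R) : {for p, continuous (fun q : R * R => q.2)}.
Proof. exact: cvg_snd. Qed.

Lemma continuous_phase (p : R * R) : {for p, continuous phase}.
Proof.
by rewrite /phase; continuity_by (first [exact: continuous_proj1 | exact: continuous_proj2]).
Qed.

Lemma open_phase_preimage (I : set R) : open I -> open (phase @^-1` I).
Proof. by apply: open_comp => p _; exact: continuous_phase. Qed.

Lemma continuous_comp_phase (g : R -> R) (p : R * R) :
  {for phase p, continuous g} -> {for p, continuous (fun q => g (phase q))}.
Proof. by apply: continuous_compf; exact: continuous_phase. Qed.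

Lemma is_derive_phase_x (g : R -> R) (p : R * R) (dg : R) :
  is_derive (phase p) 1 g dg ->
  is_derive p ((1, 0) : R * R) (fun q => g (phase q)) (- b * dg).
Proof.
case: p => x y gd; apply/is_derive_xP.
rewrite mulrC; apply: is_derive1_comp => /=.
rewrite /phase/=.
apply: has_derive_eq; first by derivative_by (exact: is_derive_id).
by rewrite !mulr0 !addr0 sub0r mulr1.
Qed.

Lemma is_derive_phase_y (g : R -> R) (p : R * R) (dg : R) :
  is_derive (phase p) 1 g dg ->
  is_derive p ((0, 1) : R * R) (fun q => g (phase q)) (a * dg).
Proof.
case: p => x y gd; apply/is_derive_yP.
rewrite mulrC; apply: is_derive1_comp => /=.
rewrite /phase/=.
apply: has_derive_eq; first by derivative_by (exact: is_derive_id).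
by rewrite !mulr0 !addr0 subr0 mulr1.
Qed.

Lemma is_derive_proj1_x (p : R * R) : is_derive p ((1, 0) : R * R) (fun q => q.1) 1.
Proof. by case: p => x y; apply/is_derive_xP; exact: is_derive_id. Qed.
Lemma is_derive_proj2_x (p : R * R) : is_derive p ((1, 0) : R * R) (fun q => q.2) 0.
Proof. by case: p => x y; apply/is_derive_xP; exact: is_derive_cst. Qed.
Lemma is_derive_proj1_y (p : R * R) : is_derive p ((0, 1) : R * R) (fun q => q.1) 0.
Proof. by case: p => x y; apply/is_derive_yP; exact: is_derive_cst. Qed.
Lemma is_derive_proj2_y (p : R * R) : is_derive p ((0, 1) : R * R) (fun q => q.2) 1.
Proof. by case: p => x y; apply/is_derive_yP; exact: is_derive_id. Qed.

End Phase.

Section Smoothness.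
Context {R : realType}.

Lemma smooth1_is_derive (I : set R) (g : R -> R) (t : R) :
  smooth1 I g -> I t -> is_derive t 1 g (derive1 g t).
Proof. by move=> sg It; rewrite derive1E; apply: derivableP; exact: (sg 0%N). Qed.

Lemma smooth1_derive1 (I : set R) (g : R -> R) : smooth1 I g -> smooth1 I (derive1 g).
Proof. by move=> sg n t It; rewrite -derive1Sn; exact: sg. Qed.

Lemma is_derive1_continuous (g : R -> R) (t d : R) : is_derive t 1 g d -> {for t, continuous g}.
Proof. by move=> gd; apply/differentiable_continuous/derivable1_diffP; exact: ex_derive. Qed.

Lemma smooth1_continuous (I : set R) (g : R -> R) t :
  smooth1 I g -> I t -> {for t, continuous g}.
Proof. by move=> sg It; apply: is_derive1_continuous (smooth1_is_derive sg It). Qed.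

Lemma smooth1_comp_is_derive (J I : set R) (g f : R -> R) (t : R) :
  smooth1 J g -> smooth1 I f -> (forall s, I s -> J (f s)) -> I t ->
  is_derive t 1 (fun s => g (f s)) (derive1 g (f t) * derive1 f t).
Proof.
move=> sg sf fJ It; apply: is_derive1_comp; last exact: smooth1_is_derive It.
exact: smooth1_is_derive (fJ t It).
Qed.

(** As U is open, [Ck k U] depends on the germs of its function at the points
    of U. This replaces a partial derivative by its formula on U. *)
Lemma Ck_congr k (U : set (R * R)) (f g : R * R -> R) :
  open U -> (forall p, U p -> f p = g p) -> Ck k U f -> Ck k U g.
Proof.
move=> oU; elim: k f g => [|k IH] f g fg [cf Hf].
all: have nfg p : U p -> \forall q \near p, f q = g q
  by move=> Up; have : nbhs p U; [exact: open_nbhs_nbhs|apply: filterS => q /fg].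
all: have cg p : U p -> {for p, continuous g}
  by move=> Up; move: (cf p Up); rewrite /prop_for /continuous_at (fg p Up);
     apply: cvg_trans; apply: near_eq_cvg; apply: filterS (nfg p Up) => q ->.
  by split.
case: Hf => df Cx Cy; split; first exact: cg.
split.
- by move=> p Up; have [d1 d2] := df p Up;
    split; apply: near_eq_derivable (nfg p Up) _.
- by apply: IH Cx => p Up; apply: near_eq_derive; exact: nfg.
- by apply: IH Cy => p Up; apply: near_eq_derive; exact: nfg.
Qed.

(** This family of functions is stable under both partial derivatives, which
    makes the induction on the order of differentiability possible. *)
Lemma Ck_affine_plus_wave k (a b : R) (U : set (R * R)) (I : set R)
    (c0 c1 c2 c : R) (g : R -> R) :
  open U -> U `<=` phase a b @^-1` I -> smooth1 I g ->
  Ck k U (fun p => c0 * p.1 + c1 * p.2 + c2 + c * g (phase a b p)).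
Proof.
move=> oU UI; elim: k c0 c1 c2 c g => [|k IH] c0 c1 c2 c g sg.
all: have cont p : U p ->
    {for p, continuous (fun p => c0 * p.1 + c1 * p.2 + c2 + c * g (phase a b p))}
  by move=> /UI Ip; continuity_by (first [exact: continuous_proj1 | exact: continuous_proj2
     | apply: continuous_comp_phase; exact: smooth1_continuous Ip]).
  by split.
have dx p : U p -> is_derive p ((1, 0) : R * R)
    (fun p => c0 * p.1 + c1 * p.2 + c2 + c * g (phase a b p))
    (0 * p.1 + 0 * p.2 + c0 + (- b * c) * derive1 g (phase a b p)).
  move=> /UI Ip; apply: has_derive_eq.
    derivative_by (first [exact: is_derive_proj1_x | exact: is_derive_proj2_x
      | apply: is_derive_phase_x; exact: smooth1_is_derive Ip]).
  by rewrite !mulr0 !mul0r !addr0 !add0r mulr1 mulrCA mulrA.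
have dy p : U p -> is_derive p ((0, 1) : R * R)
    (fun p => c0 * p.1 + c1 * p.2 + c2 + c * g (phase a b p))
    (0 * p.1 + 0 * p.2 + c1 + (a * c) * derive1 g (phase a b p)).
  move=> /UI Ip; apply: has_derive_eq.
    derivative_by (first [exact: is_derive_proj1_y | exact: is_derive_proj2_y
      | apply: is_derive_phase_y; exact: smooth1_is_derive Ip]).
  by rewrite !mulr0 !mul0r !addr0 !add0r mulr1 mulrCA mulrA.
split => //; split.
- move=> p Up; split; first exact: (@ex_derive _ _ _ _ _ _ _ (dx p Up)).
  exact: (@ex_derive _ _ _ _ _ _ _ (dy p Up)).
- apply: (Ck_congr oU) (IH 0 0 c0 (- b * c) _ (smooth1_derive1 sg)) => p Up.
  by rewrite /partial_x (@derive_val _ _ _ _ _ _ _ (dx p Up)).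
- apply: (Ck_congr oU) (IH 0 0 c1 (a * c) _ (smooth1_derive1 sg)) => p Up.
  by rewrite /partial_y (@derive_val _ _ _ _ _ _ _ (dy p Up)).
Qed.

Lemma smooth2_continuous (f : R * R -> R) (U : set (R * R)) (p : R * R) :
  smooth2 U f -> U p -> {for p, continuous f}.
Proof. by move=> /(_ 0%N)[cf _]; exact: cf. Qed.

Lemma smooth2_partial_x (f : R * R -> R) (U : set (R * R)) (p : R * R) : smooth2 U f -> U p ->
  is_derive p ((1, 0) : R * R) f (partial_x f p) /\ {for p, continuous (partial_x f)}.
Proof.
move=> /(_ 1%N)[_ [df [cx _] _]] Up; split; last exact: cx.
exact: (derivableP (df p Up).1).
Qed.

Lemma smooth2_partial_y (f : R * R -> R) (U : set (R * R)) (p : R * R) : smooth2 U f -> U p ->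
  is_derive p ((0, 1) : R * R) f (partial_y f p) /\ {for p, continuous (partial_y f)}.
Proof.
move=> /(_ 1%N)[_ [df _ [cy _]]] Up; split; last exact: cy.
exact: (derivableP (df p Up).2).
Qed.

End Smoothness.

(** * Divergences of transported test fields *)

Section IntegratesToZero.
Context {R : realType}.

Definition integrates_to_zero (K : set (R * R)) (f : R * R -> R) :=
  mu2.-integrable (K : set (plane R)) (EFin \o f : plane R -> _) /\
  Rintegral mu2 (K : set (plane R)) f = 0.

Lemma integrates_to_zero_add K f g : compact K -> integrates_to_zero K f ->
  integrates_to_zero K g -> integrates_to_zero K (fun p => f p + g p).
Proof.
move=> /compact_measurable_plane mK [fi f0] [gi g0]; split.
  by apply: (integrableD mK fi gi).
by rewrite RintegralD// f0 g0 addr0.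
Qed.

Lemma integrates_to_zero_scale K f (c : R) : compact K -> integrates_to_zero K f ->
  integrates_to_zero K (fun p => c * f p).
Proof.
move=> /compact_measurable_plane mK [fi f0]; split.
  by apply: (integrableZl mK c fi).
by rewrite RintegralZl// f0 mulr0.
Qed.

End IntegratesToZero.

Section TransportedTestFunction.
Context {R : realType} (a b : R).
Variables (I : set R) (alpha dalpha : R -> R) (eta : R * R -> R) (K : set (R * R)).
Hypothesis alpha_der : forall t, I t -> is_derive t 1 alpha (dalpha t).
Hypothesis dalpha_cont : forall t, I t -> {for t, continuous dalpha}.
Hypothesis eta_smooth : smooth2 setT eta.
Hypothesis cK : compact K.
Hypothesis KI : K `<=` phase a b @^-1` I.
Hypothesis etaK : forall p, ~ K p -> eta p = 0.

Let closedK : closed K.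
Proof. by apply: compact_closed => //; exact: norm_hausdorff. Qed.

Let nearNK p : ~ K p -> \forall q \near p, ~ K q.
Proof. by move=> Kp; apply: open_nbhs_nbhs; split => //; exact: closed_openC. Qed.

Let continuous_near0 (f : R * R -> R) p : (forall q, ~ K q -> f q = 0) -> ~ K p ->
  {for p, continuous f}.
Proof.
move=> f0 Kp; rewrite /prop_for /continuous_at (f0 p Kp).
apply: (@cvg_trans _ (nbhs (0 : R) : set_system R)); last by [].
apply: cvg_near_cst; apply: filterS (nearNK Kp) => q /f0 ->; exact/eqP.
Qed.

(** Off K the product [alpha (phase a b p) * eta p] is zero whatever [alpha]
    does outside [I], so it is differentiable on the whole plane. The direction
    [v], its derivative [deta] of [eta] and the slope [c] of the phase along
    [v] are abstract in order to treat both coordinate directions at once. *)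
Let integrates_to_zero_partial (v : R * R) (c : R) (deta : R * R -> R) :
  (forall (g : R -> R) (p : R * R) (dg : R), is_derive (phase a b p) 1 g dg ->
     is_derive p v (fun q => g (phase a b q)) (c * dg)) ->
  (forall f df : R * R -> R, (forall p : R * R, is_derive p v f (df p)) ->
     continuous df -> (forall p, ~ K p -> f p = 0) ->
     Rintegral mu2 (K : set (plane R)) df = 0) ->
  (forall p : R * R, is_derive p v eta (deta p) /\ {for p, continuous deta}) ->
  integrates_to_zero K (fun p => alpha (phase a b p) * deta p
                                 + eta p * (c * dalpha (phase a b p))).
Proof.
move=> phase_der integral0 deta_spec.
set f := fun p => _.
have deta0 p : ~ K p -> deta p = 0.
  move=> Kp; have [ed _] := deta_spec p.
  exact: (is_derive_vanish_off_closed closedK etaK Kp ed).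
have cf (p : R * R) : {for p, continuous f}.
  have [Kp|Kp] := pselect (K p); last first.
    by apply: continuous_near0 Kp => q Kq; rewrite /f etaK// deta0// mulr0 mul0r addr0.
  rewrite /f; have Ip := KI Kp.
  continuity_by (first [exact: (smooth2_continuous eta_smooth (Logic.I : setT p))
    | exact: (deta_spec p).2
    | apply: (@continuous_comp_phase _ _ _ dalpha); exact: dalpha_cont
    | apply: (@continuous_comp_phase _ _ _ alpha);
      exact: is_derive1_continuous (alpha_der Ip)]).
split.
  apply: continuous_compact_integrable_plane => //; exact: continuous_subspaceT.
apply: (integral0 (fun p => alpha (phase a b p) * eta p)).
- move=> p; have [ed _] := deta_spec p.
  have [Kp|Kp] := pselect (K p).
    apply: has_derive_mul; last exact: ed.
    by apply: phase_der; exact/alpha_der/KI.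
  rewrite /f etaK// deta0// mulr0 mul0r addr0.
  apply: (near_eq_is_derive _ (is_derive_cst 0 p _)).
  by apply: filterS (nearNK Kp) => q /etaK ->; rewrite mulr0.
- exact: cf.
- by move=> p /etaK ->; rewrite mulr0.
Qed.

Lemma integrates_to_zero_partial_x :
  integrates_to_zero K (fun p => alpha (phase a b p) * partial_x eta p
                                 + eta p * (- b * dalpha (phase a b p))).
Proof.
apply: (@integrates_to_zero_partial (1, 0)).
- exact: is_derive_phase_x.
- by move=> f df; exact: Rintegral_partial_x0.
- by move=> p; exact: smooth2_partial_x eta_smooth (Logic.I : setT p).
Qed.

Lemma integrates_to_zero_partial_y :
  integrates_to_zero K (fun p => alpha (phase a b p) * partial_y eta p
                                 + eta p * (a * dalpha (phase a b p))).
Proof.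
apply: (@integrates_to_zero_partial (0, 1)).
- exact: is_derive_phase_y.
- by move=> f df; exact: Rintegral_partial_y0.
- by move=> p; exact: smooth2_partial_y eta_smooth (Logic.I : setT p).
Qed.

End TransportedTestFunction.

(** * First variation of the energy *)

Section DerivativeOfIntegral.
Context {R : realType}.

(** A constant dominates the parameter derivative: [dL 0] is bounded on K, and
    by a covering argument the same bound plus one holds on K for all small s. *)
Lemma is_derive_Rintegral_compact (L dL : R -> R * R -> R) (K : set (R * R)) :
  compact K ->
  (forall p, K p -> \forall q \near p & s \near (0 : R), K q ->
     {for q, continuous (L s)} /\ is_derive (s : R) (1 : R) (L ^~ q) (dL s q)) ->
  (forall p, K p -> {for (p, 0), continuous (fun z : (R * R) * R => dL z.2 z.1)}) ->
  is_derive (0 : R) (1 : R) (fun s => Rintegral mu2 (K : set (plane R)) (L s))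
    (Rintegral mu2 (K : set (plane R)) (dL 0)).
Proof.
move=> cK HL HdL.
have mK := compact_measurable_plane cK.
have dL0c : {within K, continuous (dL 0)}.
  apply: continuous_in_subspaceT => p; rewrite inE => Kp.
  apply: (@continuous_comp _ _ _ (fun q : R * R => (q, 0 : R)) (fun z => dL z.2 z.1)).
    by apply: continuous_pair; [exact: cvg_id | exact: cvg_cst].
  exact: HdL.
have [M [_ MB]] := compact_bounded (continuous_compact dL0c cK).
pose C := `|M| + 1.
have dL0C q : K q -> `|dL 0 q| <= C.
  by move=> Kq; apply: (MB C); [rewrite /C (le_lt_trans (ler_norm M))// ltrDl|exists q].
pose P (s : R) (q : R * R) := K q -> [/\ {for q, continuous (L s)},
   is_derive (s : R) (1 : R) (L ^~ q) (dL s q) & `|dL s q| <= C + 1].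
have : \forall s \near (0 : R), K `<=` P s.
  apply: ((compact_near_coveringP K).1 cK R (nbhs (0 : R)) P) => p Kp.
  have bnd : \forall q \near p & s \near (0 : R), `|dL s q| < C + 1.
    have cdL : dL z.2 z.1 @[z --> (p, 0)] --> dL 0 p by exact: HdL.
    have C1 : `|dL 0 p| < C + 1 by rewrite (le_lt_trans (dL0C p Kp))// ltrDl.
    exact: (cvgr_norm_lt _ cdL _ C1).
  apply: filterS2 (HL p Kp) bnd => -[q s] /= H1 /ltW H2 Kq.
  by have [? ?] := H1 Kq; split.
case/nbhs_ballP => e /= e0 He.
have He' s : `](- e), e[%classic s -> forall q, K q -> [/\ {for q, continuous (L s)},
   is_derive (s : R) (1 : R) (L ^~ q) (dL s q) & `|dL s q| <= C + 1].
  rewrite /= in_itv/= -ltr_norml => se q Kq.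
  by apply: (He s) => //; rewrite /ball/= sub0r normrN.
have e00 : `](- e), e[%classic (0 : R) by rewrite /= in_itv/= oppr_lt0 e0.
have dLE s q : `](- e), e[%classic s -> K q -> partial1of2 L s q = dL s q.
  move=> es Kq; have [_ d _] := He' s es q Kq.
  by rewrite partial1of2E (@derive_val _ _ _ _ _ _ _ d).
have intL s : `](- e), e[%classic s -> mu2.-integrable (K : set (plane R)) (EFin \o (L s)).
  move=> es; apply: continuous_compact_integrable_plane => //.
  by apply: continuous_in_subspaceT => q; rewrite inE => Kq; have [] := He' s es q Kq.
have derL s q : `](- e), e[%classic s -> K q -> derivable (L ^~ q) s 1.
  by move=> es Kq; have [_ d _] := He' s es q Kq; exact: (@ex_derive _ _ _ _ _ _ _ d).
have C0 : 0 <= C + 1 by rewrite addr_ge0// addr_ge0.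
have intC : mu2.-integrable (K : set (plane R)) (EFin \o (cst (C + 1))).
  by apply: continuous_compact_integrable_plane => // q; exact: cvg_cst.
have bndL s q : `](- e), e[%classic s -> K q -> `|partial1of2 L s q| <= cst (C + 1) q.
  by move=> es Kq; rewrite dLE//; have [_ _] := He' s es q Kq.
have lim := @cvg_differentiation_under_integral R _ _ mu2 L K mK 0 (- e) e e00 intL
  derL (cst (C + 1)) (fun=> C0) intC bndL.
have E : Rintegral mu2 (K : set (plane R)) (partial1of2 L 0) =
    Rintegral mu2 (K : set (plane R)) (dL 0).
  by apply: eq_Rintegral => q; rewrite inE => Kq; exact: dLE.
have lim' : h^-1 *: (Rintegral mu2 (K : set (plane R)) (L (h *: 1 + 0)) -
    Rintegral mu2 (K : set (plane R)) (L 0)) @[h --> 0^'] -->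
    Rintegral mu2 (K : set (plane R)) (dL 0).
  rewrite -E; under eq_fun do rewrite [_ *: 1]mulr1; exact: lim.
split; first by apply/cvg_ex; eexists; exact: lim'.
exact: cvg_lim lim'.
Qed.

End DerivativeOfIntegral.

Section FirstVariation.
Context {R : realType}.
Variables (e d : R) (A dA B dB : R -> R).

(** The real form of the energy density of a map (r, s), as a function of its
    1-jet; e and d stand for eps^2 and delta^2. *)
Definition lagrangian (r rx ry sx sy : R) : R :=
  4^-1 * (A r * (rx * rx - e * (ry * ry)) - d * (B r * (sx * sx - e * (sy * sy)))).

(** The differential of [lagrangian] at a 1-jet in the direction of the 1-jet of
    a variation (h, k); k enters through its first derivatives because the
    metric coefficients are functions of r alone. *)
Definition lagrangian_diff (r rx ry sx sy h hx hy kx ky : R) : R :=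
  4^-1 * (dA r * h * (rx * rx - e * (ry * ry)) + A r * (2 * (rx * hx - e * (ry * hy)))
   - d * (dB r * h * (sx * sx - e * (sy * sy)) + B r * (2 * (sx * kx - e * (sy * ky))))).

Variables (J : set R) (K : set (R * R)).
Variables (r rx ry sx sy h hx hy kx ky : R * R -> R).
Hypothesis oJ : open J.
Hypothesis A_der : forall y, J y -> is_derive y 1 A (dA y).
Hypothesis B_der : forall y, J y -> is_derive y 1 B (dB y).
Hypothesis dA_cont : forall y, J y -> {for y, continuous dA}.
Hypothesis dB_cont : forall y, J y -> {for y, continuous dB}.
Hypothesis cK : compact K.
Hypothesis rJ : forall p, K p -> J (r p).
Hypotheses (cr : forall p, K p -> {for p, continuous r})
  (crx : forall p, K p -> {for p, continuous rx})
  (cry : forall p, K p -> {for p, continuous ry})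
  (csx : forall p, K p -> {for p, continuous sx})
  (csy : forall p, K p -> {for p, continuous sy})
  (ch : forall p, K p -> {for p, continuous h})
  (chx : forall p, K p -> {for p, continuous hx})
  (chy : forall p, K p -> {for p, continuous hy})
  (ckx : forall p, K p -> {for p, continuous kx})
  (cky : forall p, K p -> {for p, continuous ky}).

Let L (s : R) (p : R * R) : R := lagrangian (r p + s * h p) (rx p + s * hx p)
  (ry p + s * hy p) (sx p + s * kx p) (sy p + s * ky p).

Let dL (s : R) (p : R * R) : R := lagrangian_diff (r p + s * h p) (rx p + s * hx p)
  (ry p + s * hy p) (sx p + s * kx p) (sy p + s * ky p) (h p) (hx p) (hy p) (kx p) (ky p).

Let cont1 (f : R * R -> R) (p : R * R) (s : R) : {for p, continuous f} ->
  {for (p, s), continuous (fun z : (R * R) * R => f z.1)}.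
Proof. by move=> cf; apply: (@continuous_comp _ _ _ fst f); [exact: cvg_fst|exact: cf]. Qed.

Let cont2 (p : R * R) (s : R) : {for (p, s), continuous (fun z : (R * R) * R => z.2)}.
Proof. exact: cvg_snd. Qed.

Let Jc (g : R -> R) : (forall y, J y -> {for y, continuous g}) ->
  forall p, K p -> {for (p, 0), continuous (fun z : (R * R) * R => g (r z.1 + z.2 * h z.1))}.
Proof.
move=> cg p Kp; apply: (@continuous_compf _ _ g (fun z : (R * R) * R => r z.1 + z.2 * h z.1)).
  continuity_by (first [exact: cont2 | apply: cont1; first [exact: cr | exact: ch]]).
by apply: cg; rewrite /= mul0r addr0; exact: rJ.
Qed.

Ltac field_leaf := lazymatch goal with
  | |- context [r] => exact: cr | |- context [h] => exact: ch
  | |- context [rx] => exact: crx | |- context [ry] => exact: cry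
  | |- context [sx] => exact: csx | |- context [sy] => exact: csy
  | |- context [hx] => exact: chx | |- context [hy] => exact: chy
  | |- context [kx] => exact: ckx | |- context [ky] => exact: cky end.

(** As K is compact and J open, [r + s h] stays in J on K for small s, so that
    only the values of A and B on J matter. *)
Lemma is_derive_Rintegral_lagrangian :
  is_derive (0 : R) 1 (fun s => Rintegral mu2 (K : set (plane R)) (L s))
    (Rintegral mu2 (K : set (plane R)) (dL 0)).
Proof.
have cA y : J y -> {for y, continuous A}.
  by move=> Jy; exact: is_derive1_continuous (A_der Jy).
have cB y : J y -> {for y, continuous B}.
  by move=> Jy; exact: is_derive1_continuous (B_der Jy).
apply: is_derive_Rintegral_compact => // p Kp.
- have crh : {for (p, 0), continuous (fun z : (R * R) * R => r z.1 + z.2 * h z.1)}.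
    continuity_by (first [exact: cont2 | apply: cont1; first [exact: cr | exact: ch]]).
  have nJ : nbhs (r p + 0 * h p) J.
    by apply: open_nbhs_nbhs; split => //; rewrite mul0r addr0; exact: rJ.
  have Jnear : \forall q \near p & s \near (0 : R), J (r q + s * h q) by exact: (crh J nJ).
  apply: filterS Jnear => -[q s] /= Jqs Kq; split.
    rewrite /L /lagrangian.
    continuity_by (idtac; lazymatch goal with
      | |- context [A _] =>
        apply: (@continuous_compf _ _ A (fun q => r q + s * h q)); last exact: cA
      | |- context [B _] =>
        apply: (@continuous_compf _ _ B (fun q => r q + s * h q)); last exact: cB
      | |- _ => field_leaf end).
  rewrite /L /lagrangian.
  have drh : is_derive s 1 (fun s => r q + s * h q) (h q).
    apply: has_derive_eq; first by derivative_by (exact: is_derive_id).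
    by rewrite mulr0 mulr1 !add0r.
  have dAq : has_derive s 1 (fun s => A (r q + s * h q)) (dA (r q + s * h q) * h q).
    by apply: is_derive1_comp; exact: A_der.
  have dBq : has_derive s 1 (fun s => B (r q + s * h q)) (dB (r q + s * h q) * h q).
    by apply: is_derive1_comp; exact: B_der.
  apply: has_derive_eq.
    derivative_by (first [exact: dAq | exact: dBq | exact: is_derive_id]).
  rewrite /dL /lagrangian_diff !mulr1; ring.
- rewrite /dL /lagrangian_diff.
  continuity_by (idtac; lazymatch goal with
    | |- context [A _] => exact: (Jc cA)
    | |- context [B _] => exact: (Jc cB)
    | |- context [dA _] => exact: (Jc dA_cont)
    | |- context [dB _] => exact: (Jc dB_cont)
    | |- context [snd] => exact: cont2
    | |- _ => apply: cont1; field_leaf end).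
Qed.

End FirstVariation.

(** * From complex to real coefficients *)

Section RealComplex.
Context {R : realType}.
Implicit Types x y : R.
Lemma real_complex_mul x y : (x * y)%:C = x%:C * y%:C. Proof. exact: rmorphM. Qed.
Lemma real_complex_add x y : (x + y)%:C = x%:C + y%:C. Proof. exact: rmorphD. Qed.
Lemma real_complex_opp x : (- x)%:C = - x%:C. Proof. exact: rmorphN. Qed.
Lemma real_complex_inv x : (x^-1)%:C = x%:C^-1. Proof. exact: fmorphV. Qed.
Lemma real_complex_expr x n : (x ^+ n)%:C = x%:C ^+ n. Proof. exact: rmorphXn. Qed.
Lemma real_complex_nat n : (n%:R : R)%:C = n%:R. Proof. exact: rmorph_nat. Qed.
Definition real_complexE := (real_complex_mul, real_complex_add, real_complex_opp,
  real_complex_inv, real_complex_expr, real_complex_nat).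
End RealComplex.

Section RealForm.
Context {R : realType}.

Lemma unit_square_real (z : R[i]) : z = 1 \/ z = 'i ->
  exists2 e : R, e = 1 \/ e = -1 & z ^+ 2 = e%:C /\ z^-1 ^+ 2 = e%:C.
Proof.
case=> ->; first by exists 1; [left|rewrite invr1 expr1n].
by exists (-1); [right|rewrite exprVn sqr_i invrN1 rmorphN rmorph1].
Qed.

Lemma Re_energy_density (eps delta : R[i]) (e d : R) A B (u : R * R -> R * R) p :
  eps^-1 ^+ 2 = e%:C -> delta ^+ 2 = d%:C ->
  complex.Re (energy_density eps delta A B u p) =
  lagrangian e d A B (u p).1
    (partial_x (fun q => (u q).1) p) (partial_y (fun q => (u q).1) p)
    (partial_x (fun q => (u q).2) p) (partial_y (fun q => (u q).2) p).
Proof.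
move=> eE dE.
have prodE (z : R[i]) f q :
    z * diff_v eps f q * diff_w eps f q =
    z * (4^-1 * (partial_x f q * partial_x f q - e * (partial_y f q * partial_y f q)))%:C.
  rewrite -(mulrA z); congr (_ * _).
  rewrite /diff_v /diff_w mulrACA (mulrC (_ + _)) -subr_sqr exprMn eE.
  have -> : 2^-1 * 2^-1 = (4^-1 : R)%:C.
    by rewrite -invfM -natrM fmorphV rmorph_nat.
  by rewrite -!rmorphXn -rmorphM -rmorphB -rmorphM.
rewrite /energy_density /= !prodE dE -!rmorphM -rmorphB /=.
by rewrite /lagrangian; ring.
Qed.

End RealForm.

(** * The profile equations *)

Section Profile.
Context {R : realType}.
Variables (e d a b kappa lambda : R) (A B : R -> R) (r H : R -> R).
Variables (J I : set R).

Let D := b ^+ 2 - e * a ^+ 2.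
Let n := a ^+ 2 + b ^+ 2.
Let sigma := 2 * kappa * (a * b) + lambda * (b ^+ 2 + e * a ^+ 2).

Hypothesis he : e = 1 \/ e = -1.
Hypothesis hd : d = 1 \/ d = -1.
Hypothesis D0 : D != 0.
Hypothesis n0 : n != 0.
Hypothesis oI : open I.
Hypothesis sA : smooth1 J A.
Hypothesis sB : smooth1 J B.
Hypothesis B0 : forall y, J y -> B y != 0.
Hypothesis sr : smooth1 I r.
Hypothesis sH : smooth1 I H.
Hypothesis rJ : forall t, I t -> J (r t).
Hypothesis r'0 : forall t, I t -> derive1 r t != 0.

Let r1 := derive1 r. Let r2 := derive1 r1.
Let H1 := derive1 H. Let H2 := derive1 H1.
Let dA := derive1 A. Let dB := derive1 B.

Hypothesis H1_eq : forall t, I t ->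
  D * (n * (B (r t) * H1 t)) = 2 * d * sigma + a * b * (n * ((e + 1) * B (r t))).
Hypothesis r1_eq : forall t, I t ->
  n ^+ 2 * D ^+ 2 * (A (r t) * (B (r t) * (r1 t * r1 t))) =
  d * e * n ^+ 4 * (B (r t) * B (r t))
  + 4 * n ^+ 2 * (kappa * (b ^+ 2 + e * a ^+ 2) + 2 * e * (a * b) * lambda) * B (r t)
  + 4 * d * sigma ^+ 2.

Let near_eq_derive_eq (f g : R -> R) (t df dg : R) : I t ->
  (forall s, I s -> f s = g s) -> has_derive t 1 f df -> has_derive t 1 g dg -> df = dg.
Proof.
move=> It fg fd gd.
have fgt : \forall s \near t, f s = g s.
  by have : nbhs t I; [exact: open_nbhs_nbhs|apply: filterS => s /fg].
rewrite -(@derive_val _ _ _ _ _ _ _ fd) -(@derive_val _ _ _ _ _ _ _ gd).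
exact: near_eq_derive.
Qed.

Let r_der t : I t -> has_derive t 1 r (r1 t).
Proof. exact: smooth1_is_derive. Qed.
Let r1_der t : I t -> has_derive t 1 r1 (r2 t).
Proof. exact: (smooth1_is_derive (smooth1_derive1 sr)). Qed.
Let H1_der t : I t -> has_derive t 1 H1 (H2 t).
Proof. exact: (smooth1_is_derive (smooth1_derive1 sH)). Qed.
Let Ar_der t : I t -> has_derive t 1 (fun s => A (r s)) (dA (r t) * r1 t).
Proof. exact: (smooth1_comp_is_derive sA sr rJ). Qed.
Let Br_der t : I t -> has_derive t 1 (fun s => B (r s)) (dB (r t) * r1 t).
Proof. exact: (smooth1_comp_is_derive sB sr rJ). Qed.

Ltac profile_der It := derivative_by (idtac; first [exact: (Br_der It) | exact: (Ar_der It)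
  | exact: (r_der It) | exact: (r1_der It) | exact: (H1_der It)]).

(** [H1_eq] says that [n * B (r t) * (D * H1 t - a * b * (e + 1))] is the
    constant [2 * d * sigma]; this is its derivative divided by [n]. *)
Lemma profile_S_equation t : I t ->
  dB (r t) * r1 t * (D * H1 t - a * b * (e + 1)) + B (r t) * (D * H2 t) = 0.
Proof.
move=> It.
have := near_eq_derive_eq It H1_eq ltac:(profile_der It) ltac:(profile_der It).
move=> E; apply: (mulfI n0); rewrite mulr0.
by move/eqP: E; rewrite -subr_eq0 => /eqP <-; ring.
Qed.

(** The derivative of the energy integral [r1_eq] is r' times this second order
    equation, up to a multiple of [r1_eq] itself; where r' vanishes, that
    derivative gives no information on r''. *)
Lemma profile_R_equation t : I t ->
  D * (dA (r t) * (r1 t * r1 t) + 2 * (A (r t) * r2 t)) =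
  - d * dB (r t) * ((a - b * H1 t) ^+ 2 - e * (b + a * H1 t) ^+ 2).
Proof.
move=> It.
have E := near_eq_derive_eq It r1_eq ltac:(profile_der It) ltac:(profile_der It).
have := H1_eq It; have := r1_eq It.
have r1n := r'0 It; have Bn := B0 (rJ It).
rewrite -/(r1 t) in r1n.
set x := r1 t in E r1n *; set y := r2 t in E *; set h := H1 t.
set vA := A (r t) in E *; set vB := B (r t) in E Bn *.
set wA := dA (r t) in E *; set wB := dB (r t) in E *.
move=> rE hE.
(* the differentiated energy identity, divided by r' *)
have E1 : n ^+ 2 * D ^+ 2 * (wA * vB * (x * x) + vA * wB * (x * x) + 2 * vA * vB * y) =
    (2 * (d * e * n ^+ 4) * vB
     + 4 * n ^+ 2 * (kappa * (b ^+ 2 + e * a ^+ 2) + 2 * e * (a * b) * lambda)) * wB.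
  apply: (mulfI r1n); move/eqP: E; rewrite -subr_eq0 => /eqP E.
  by apply/eqP; rewrite -subr_eq0 -E; apply/eqP; ring.
(* eliminating r'^2 by the energy integral cancels the linear term in B *)
have E2 : n ^+ 2 * D ^+ 2 * (vB * vB) * (wA * (x * x) + 2 * (vA * y)) =
   wB * (d * e * n ^+ 4 * (vB * vB) - 4 * d * sigma ^+ 2).
  transitivity (vB * (n ^+ 2 * D ^+ 2 * (wA * vB * (x * x) + vA * wB * (x * x) + 2 * vA * vB * y))
     - wB * (n ^+ 2 * D ^+ 2 * (vA * (vB * (x * x))))); first by ring.
  by rewrite E1 rE; ring.
have nz : n ^+ 2 * D * (vB * vB) != 0 by rewrite !mulf_neq0// expf_neq0.
apply: (mulfI nz).
transitivity (n ^+ 2 * D ^+ 2 * (vB * vB) * (wA * (x * x) + 2 * (vA * y))); first by ring.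
rewrite E2.
(* the right-hand side as a polynomial in D n B H', whose value is known *)
transitivity (- d * wB * ((a ^+ 2 - e * b ^+ 2) * (n ^+ 2 * D * (vB * vB))
   + (D * (n * (vB * h))) ^+ 2
   - 2 * (a * b) * (1 + e) * n * vB * (D * (n * (vB * h))))); last first.
  by rewrite /D; ring.
rewrite hE /D /n.
by case: he => ->; case: hd => ->; ring.
Qed.

End Profile.

(** * Criticality of travelling waves *)

Section Critical.
Context {R : realType}.
Variables (eps delta : R[i]) (e d a b : R) (A B r H : R -> R) (J I : set R) (U : set (R * R)).
Hypothesis epsE : eps^-1 ^+ 2 = e%:C.
Hypothesis deltaE : delta ^+ 2 = d%:C.
Hypothesis oJ : open J.
Hypothesis sA : smooth1 J A.
Hypothesis sB : smooth1 J B.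
Hypothesis sr : smooth1 I r.
Hypothesis sH : smooth1 I H.
Hypothesis rJ : forall t, I t -> J (r t).
Hypothesis UI : U `<=` phase a b @^-1` I.

Let D := b ^+ 2 - e * a ^+ 2.
Let r1 := derive1 r. Let r2 := derive1 r1.
Let H1 := derive1 H. Let H2 := derive1 H1.
Let dA := derive1 A. Let dB := derive1 B.

Hypothesis S_equation : forall t, I t ->
  dB (r t) * r1 t * (D * H1 t - a * b * (e + 1)) + B (r t) * (D * H2 t) = 0.
Hypothesis R_equation : forall t, I t ->
  D * (dA (r t) * (r1 t * r1 t) + 2 * (A (r t) * r2 t)) =
  - d * dB (r t) * ((a - b * H1 t) ^+ 2 - e * (b + a * H1 t) ^+ 2).

Let u (p : R * R) : R * R :=
  (r (phase a b p), a * p.1 + b * p.2 + H (phase a b p)).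

Let r_der t : I t -> has_derive t 1 r (r1 t).
Proof. exact: smooth1_is_derive. Qed.
Let r1_der t : I t -> has_derive t 1 r1 (r2 t).
Proof. exact: (smooth1_is_derive (smooth1_derive1 sr)). Qed.
Let H_der t : I t -> has_derive t 1 H (H1 t).
Proof. exact: smooth1_is_derive. Qed.
Let H1_der t : I t -> has_derive t 1 H1 (H2 t).
Proof. exact: (smooth1_is_derive (smooth1_derive1 sH)). Qed.
Let Ar_der t : I t -> has_derive t 1 (fun s => A (r s)) (dA (r t) * r1 t).
Proof. exact: (smooth1_comp_is_derive sA sr rJ). Qed.
Let Br_der t : I t -> has_derive t 1 (fun s => B (r s)) (dB (r t) * r1 t).
Proof. exact: (smooth1_comp_is_derive sB sr rJ). Qed.

Let cont_r t : I t -> {for t, continuous r}. Proof. exact: smooth1_continuous. Qed.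
Let cont_r1 t : I t -> {for t, continuous r1}.
Proof. exact: smooth1_continuous (smooth1_derive1 sr). Qed.
Let cont_r2 t : I t -> {for t, continuous r2}.
Proof. exact: smooth1_continuous (smooth1_derive1 (smooth1_derive1 sr)). Qed.
Let cont_H1 t : I t -> {for t, continuous H1}.
Proof. exact: smooth1_continuous (smooth1_derive1 sH). Qed.
Let cont_H2 t : I t -> {for t, continuous H2}.
Proof. exact: smooth1_continuous (smooth1_derive1 (smooth1_derive1 sH)). Qed.
Let cont_comp (g : R -> R) t : smooth1 J g -> I t -> {for t, continuous (fun s => g (r s))}.
Proof.
move=> sg It; apply: (@continuous_compf _ _ g r); first exact: cont_r.
exact: smooth1_continuous sg (rJ It).
Qed.

(* A(r) r', and the momenta B(r) s_x and B(r) s_y of s = a x + b y + H *)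
Let mR t := A (r t) * r1 t.
Let mX t := B (r t) * (a - b * H1 t).
Let mY t := B (r t) * (b + a * H1 t).
Let dmR t := A (r t) * r2 t + r1 t * (dA (r t) * r1 t).
Let dmX t := B (r t) * (0 - b * H2 t) + (a - b * H1 t) * (dB (r t) * r1 t).
Let dmY t := B (r t) * (a * H2 t) + (b + a * H1 t) * (dB (r t) * r1 t).

Let mR_der t : I t -> is_derive t 1 mR (dmR t).
Proof. by move=> It; apply: has_derive_mul; [exact: Ar_der|exact: r1_der]. Qed.

Let mX_der t : I t -> is_derive t 1 mX (dmX t).
Proof.
move=> It; rewrite /mX; apply: has_derive_eq.
  derivative_by (idtac; first [exact: (Br_der It)|exact: (H1_der It)]).
by rewrite /dmX; ring.
Qed.

Let mY_der t : I t -> is_derive t 1 mY (dmY t).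
Proof.
move=> It; rewrite /mY; apply: has_derive_eq.
  derivative_by (idtac; first [exact: (Br_der It)|exact: (H1_der It)]).
by rewrite /dmY; ring.
Qed.

Ltac cont_leaf It := idtac; lazymatch goal with
  | |- context [A _] => exact: (cont_comp sA It)
  | |- context [B _] => exact: (cont_comp sB It)
  | |- context [dA _] => exact: (cont_comp (smooth1_derive1 sA) It)
  | |- context [dB _] => exact: (cont_comp (smooth1_derive1 sB) It)
  | |- context [r1] => exact: (cont_r1 It)
  | |- context [r2] => exact: (cont_r2 It)
  | |- context [H1] => exact: (cont_H1 It)
  | |- context [H2] => exact: (cont_H2 It) end.

Let cont_dmR t : I t -> {for t, continuous dmR}.
Proof. by move=> It; rewrite /dmR; continuity_by (cont_leaf It). Qed.

Let cont_dmX t : I t -> {for t, continuous dmX}.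
Proof. by move=> It; rewrite /dmX; continuity_by (cont_leaf It). Qed.

Let cont_dmY t : I t -> {for t, continuous dmY}.
Proof. by move=> It; rewrite /dmY; continuity_by (cont_leaf It). Qed.

(** The integrand of the first variation is a combination of four partial
    derivatives of transported test fields, plus multiples of the two profile
    equations. *)
Lemma travelling_wave_critical : critical_point eps delta A B U u.
Proof.
move=> eta K [[s1 s2] _ _] cK KU etaK.
have eta0 p : ~ K p -> eta p = 0.
  move=> Kp; apply/eqP; apply/negP => /negP ep; apply: Kp; apply: etaK.
  exact: subset_closure.
pose h p := (eta p).1. pose k p := (eta p).2.
have h0 p : ~ K p -> h p = 0 by move=> /eta0; rewrite /h => ->.
have k0 p : ~ K p -> k p = 0 by move=> /eta0; rewrite /k => ->.
have KI : K `<=` phase a b @^-1` I by move=> p /KU/UI.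
pose rr p := r (phase a b p).
pose rx p := - b * r1 (phase a b p). pose ry p := a * r1 (phase a b p).
pose sx p := a - b * H1 (phase a b p). pose sy p := b + a * H1 (phase a b p).
pose hx := partial_x h. pose hy := partial_y h.
pose kx := partial_x k. pose ky := partial_y k.
pose L s p := lagrangian e d A B (rr p + s * h p) (rx p + s * hx p)
  (ry p + s * hy p) (sx p + s * kx p) (sy p + s * ky p).
have EL : (fun s : R => energy eps delta A B (fun p => u p + s *: eta p) K) =
    (fun s => Rintegral mu2 (K : set (plane R)) (L s)).
  apply/funext => s; apply: eq_Rintegral => p; rewrite inE => Kp.
  rewrite (Re_energy_density _ _ _ _ epsE deltaE).
  have Ip := KI p Kp.
  have [hxd _] := smooth2_partial_x s1 (Logic.I : setT p).
  have [hyd _] := smooth2_partial_y s1 (Logic.I : setT p).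
  have [kxd _] := smooth2_partial_x s2 (Logic.I : setT p).
  have [kyd _] := smooth2_partial_y s2 (Logic.I : setT p).
  have rxd := is_derive_phase_x (r_der Ip).
  have ryd := is_derive_phase_y (r_der Ip).
  have Hxd := is_derive_phase_x (H_der Ip).
  have Hyd := is_derive_phase_y (H_der Ip).
  have d1 : is_derive p ((1, 0) : R * R) (fun q => r (phase a b q) + s * h q) (rx p + s * hx p).
    apply: has_derive_eq; first by derivative_by (idtac; first [exact: rxd | exact: hxd]).
    by rewrite mulr0 addr0.
  have d2 : is_derive p ((0, 1) : R * R) (fun q => r (phase a b q) + s * h q) (ry p + s * hy p).
    apply: has_derive_eq; first by derivative_by (idtac; first [exact: ryd | exact: hyd]).
    by rewrite mulr0 addr0.
  have d3 : is_derive p ((1, 0) : R * R)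
      (fun q => (a * q.1 + b * q.2 + H (phase a b q)) + s * k q) (sx p + s * kx p).
    apply: has_derive_eq.
      by derivative_by (idtac; first [exact: Hxd | exact: kxd
        | exact: is_derive_proj1_x | exact: is_derive_proj2_x]).
    by rewrite /sx !mulr0 mulr1 !addr0 mulNr.
  have d4 : is_derive p ((0, 1) : R * R)
      (fun q => (a * q.1 + b * q.2 + H (phase a b q)) + s * k q) (sy p + s * ky p).
    apply: has_derive_eq.
      by derivative_by (idtac; first [exact: Hyd | exact: kyd
        | exact: is_derive_proj1_y | exact: is_derive_proj2_y]).
    by rewrite /sy !mulr0 mulr1 !addr0 add0r.
  rewrite /L /partial_x /partial_y.
  rewrite (@derive_val _ _ _ _ _ _ _ d1) (@derive_val _ _ _ _ _ _ _ d2).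
  by rewrite (@derive_val _ _ _ _ _ _ _ d3) (@derive_val _ _ _ _ _ _ _ d4).
have phaseC (g : R -> R) : (forall t, I t -> {for t, continuous g}) ->
    forall p, K p -> {for p, continuous (fun q => g (phase a b q))}.
  by move=> cg p Kp; apply: continuous_comp_phase; exact: cg (KI p Kp).
have derL : is_derive (0 : R) 1 (fun s => Rintegral mu2 (K : set (plane R)) (L s))
    (Rintegral mu2 (K : set (plane R)) (fun p => lagrangian_diff e d A dA B dB
      (rr p + 0 * h p) (rx p + 0 * hx p) (ry p + 0 * hy p) (sx p + 0 * kx p)
      (sy p + 0 * ky p) (h p) (hx p) (hy p) (kx p) (ky p))).
  apply: (@is_derive_Rintegral_lagrangian _ e d A dA B dB J).
  - exact: oJ.
  - by move=> y Jy; exact: smooth1_is_derive Jy.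
  - by move=> y Jy; exact: smooth1_is_derive Jy.
  - by move=> y Jy; exact: smooth1_continuous (smooth1_derive1 sA) Jy.
  - by move=> y Jy; exact: smooth1_continuous (smooth1_derive1 sB) Jy.
  - exact: cK.
  - by move=> p Kp; exact: rJ (KI p Kp).
  - exact: phaseC cont_r.
  - by move=> p Kp; rewrite /rx; continuity_by (idtac; exact: phaseC cont_r1 _ Kp).
  - by move=> p Kp; rewrite /ry; continuity_by (idtac; exact: phaseC cont_r1 _ Kp).
  - by move=> p Kp; rewrite /sx; continuity_by (idtac; exact: phaseC cont_H1 _ Kp).
  - by move=> p Kp; rewrite /sy; continuity_by (idtac; exact: phaseC cont_H1 _ Kp).
  - by move=> p _; exact: smooth2_continuous s1 (Logic.I : setT p).
  - by move=> p _; exact: (smooth2_partial_x s1 (Logic.I : setT p)).2.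
  - by move=> p _; exact: (smooth2_partial_y s1 (Logic.I : setT p)).2.
  - by move=> p _; exact: (smooth2_partial_x s2 (Logic.I : setT p)).2.
  - by move=> p _; exact: (smooth2_partial_y s2 (Logic.I : setT p)).2.
rewrite EL; apply: has_derive_eq derL _.
have hx0 := integrates_to_zero_partial_x mR_der cont_dmR s1 cK KI h0.
have hy0 := integrates_to_zero_partial_y mR_der cont_dmR s1 cK KI h0.
have kx0 := integrates_to_zero_partial_x mX_der cont_dmX s2 cK KI k0.
have ky0 := integrates_to_zero_partial_y mY_der cont_dmY s2 cK KI k0.
have [_ Z] := integrates_to_zero_add cK
  (integrates_to_zero_add cK (integrates_to_zero_scale (- b / 2) cK hx0)
                             (integrates_to_zero_scale (- (e * a) / 2) cK hy0))
  (integrates_to_zero_add cK (integrates_to_zero_scale (- d / 2) cK kx0)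
                             (integrates_to_zero_scale (d * e / 2) cK ky0)).
rewrite -[RHS]Z; apply: eq_Rintegral => p; rewrite inE => Kp.
have := S_equation (KI p Kp); have := R_equation (KI p Kp).
rewrite /lagrangian_diff !mul0r !addr0 /rr /rx /ry /sx /sy /dmR /dmX /dmY /mR /mX /mY.
rewrite -/h -/k -/hx -/hy -/kx -/ky -/(h p) -/(k p).
set t := phase a b p => ER ES.
(* the difference of the integrands, written in terms of the two equations *)
apply/eqP; rewrite -subr_eq0; apply/eqP.
transitivity (4^-1 * h p * (- d * dB (r t) * ((a - b * H1 t) ^+ 2 - e * (b + a * H1 t) ^+ 2)
    - D * (dA (r t) * (r1 t * r1 t) + 2 * (A (r t) * r2 t)))
  + 2^-1 * d * k p *
    (dB (r t) * r1 t * (D * H1 t - a * b * (e + 1)) + B (r t) * (D * H2 t))).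
  by rewrite /D; field.
by rewrite ER ES subrr !mulr0 addr0.
Qed.

End Critical.

(** * Harmonicity *)

Unset Implicit Arguments.

Theorem theorem4 (R : realType) (eps delta : R[i])
  (heps : eps = 1 \/ eps = 'i) (hdelta : delta = 1 \/ delta = 'i)
  (M : set (R * R)) (f : R * R -> R)
  (hM : open M) (hf : smooth2 M f)
  (J : set R) (A B : R -> R)
  (hJ : open J) (hA : smooth1 J A) (hB : smooth1 J B)
  (hApos : forall y, J y -> 0 < A y) (hBpos : forall y, J y -> 0 < B y)
  (a b kappa lambda : R)
  (hba : (b ^+ 2)%:C <> eps ^+ 2 * (a ^+ 2)%:C) (hab : a * b <> 0)
  (I : set R) (r H : R -> R)
  (hI : open I) (hIitv : is_interval I)
  (hr : smooth1 I r) (hH : smooth1 I H)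
  (hrJ : forall t, I t -> J (r t))
  (hr' : forall t, I t -> derive1 r t <> 0)
  (hHeq : forall t, I t ->
     (derive1 H t)%:C =
       (2 * lambda%:C * delta ^+ 2 * (b%:C ^+ 2 + eps ^+ 2 * a%:C ^+ 2)
        + 4 * kappa%:C * delta ^+ 2 * a%:C * b%:C
        + a%:C * b%:C * (a%:C ^+ 2 + b%:C ^+ 2) * (eps ^+ 2 + 1) * (B (r t))%:C)
       / ((b%:C ^+ 2 - eps ^+ 2 * a%:C ^+ 2) * (a%:C ^+ 2 + b%:C ^+ 2)
          * (B (r t))%:C))
  (hreq : forall t, I t ->
     let c1 := delta ^+ 2 * eps ^+ 2 * (a%:C ^+ 2 + b%:C ^+ 2) ^+ 4 in
     let c2 := 4 * (a%:C ^+ 2 + b%:C ^+ 2) ^+ 2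
                 * (b%:C ^+ 2 + eps ^+ 2 * a%:C ^+ 2) in
     let c3 := 8 * eps ^+ 2 * a%:C * b%:C * (a%:C ^+ 2 + b%:C ^+ 2) ^+ 2 in
     let c4 := 4 * delta ^+ 2
                 * (2 * kappa%:C * a%:C * b%:C
                    + lambda%:C * (b%:C ^+ 2 + eps ^+ 2 * a%:C ^+ 2)) ^+ 2 in
     ((derive1 r t)%:C) ^+ 2 =
       (c1 * (B (r t))%:C ^+ 2 + c2 * kappa%:C * (B (r t))%:C
        + c3 * lambda%:C * (B (r t))%:C + c4)
       / ((a%:C ^+ 2 + b%:C ^+ 2) ^+ 2
          * (b%:C ^+ 2 - eps ^+ 2 * a%:C ^+ 2) ^+ 2
          * (A (r t))%:C * (B (r t))%:C)) :
  let U := [set p : R * R | M p /\ I (a * p.2 - b * p.1)] in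
  let u := fun p : R * R =>
    (r (a * p.2 - b * p.1),
     a * p.1 + b * p.2 + H (a * p.2 - b * p.1)) in
  harmonic_map eps delta J A B U u /\
  (eps = 1 -> wave_map eps delta J A B U u).
Proof.
move=> U u.
suff hu : harmonic_map eps delta J A B U u by split.
have [e he [epsE epsVE]] := unit_square_real heps.
have [d hd [deltaE _]] := unit_square_real hdelta.
have D0 : b ^+ 2 - e * a ^+ 2 != 0.
  apply/eqP => D0; apply: hba; rewrite epsE -rmorphM; congr (_%:C).
  by apply/eqP; rewrite -subr_eq0 D0.
have n0 : a ^+ 2 + b ^+ 2 != 0.
  apply: lt0r_neq0; rewrite ltr_wpDr ?sqr_ge0// exprn_even_gt0//=.
  by apply/eqP => a0; apply: hab; rewrite a0 mul0r.
have A0 y : J y -> A y != 0 by move=> /hApos; exact: lt0r_neq0.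
have B0 y : J y -> B y != 0 by move=> /hBpos; exact: lt0r_neq0.
have r0 t : I t -> derive1 r t != 0 by move=> /hr' /eqP.
have H1_eq t : I t -> (b ^+ 2 - e * a ^+ 2) * ((a ^+ 2 + b ^+ 2) * (B (r t) * derive1 H t)) =
    2 * d * (2 * kappa * (a * b) + lambda * (b ^+ 2 + e * a ^+ 2))
    + a * b * ((a ^+ 2 + b ^+ 2) * ((e + 1) * B (r t))).
  move=> It; have Bn := B0 _ (hrJ _ It).
  have -> : derive1 H t = (2 * lambda * d * (b ^+ 2 + e * a ^+ 2) + 4 * kappa * d * a * b
      + a * b * (a ^+ 2 + b ^+ 2) * (e + 1) * B (r t))
      / ((b ^+ 2 - e * a ^+ 2) * (a ^+ 2 + b ^+ 2) * B (r t)).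
    by apply: complexI; rewrite (hHeq _ It) epsE deltaE !real_complexE.
  by field; rewrite Bn n0 D0.
have r1_eq t : I t -> (a ^+ 2 + b ^+ 2) ^+ 2 * (b ^+ 2 - e * a ^+ 2) ^+ 2 *
    (A (r t) * (B (r t) * (derive1 r t * derive1 r t))) =
    d * e * (a ^+ 2 + b ^+ 2) ^+ 4 * (B (r t) * B (r t))
    + 4 * (a ^+ 2 + b ^+ 2) ^+ 2
      * (kappa * (b ^+ 2 + e * a ^+ 2) + 2 * e * (a * b) * lambda) * B (r t)
    + 4 * d * (2 * kappa * (a * b) + lambda * (b ^+ 2 + e * a ^+ 2)) ^+ 2.
  move=> It; have Bn := B0 _ (hrJ _ It); have An := A0 _ (hrJ _ It).
  have -> : derive1 r t * derive1 r t = (d * e * (a ^+ 2 + b ^+ 2) ^+ 4 * B (r t) ^+ 2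
      + 4 * (a ^+ 2 + b ^+ 2) ^+ 2 * (b ^+ 2 + e * a ^+ 2) * kappa * B (r t)
      + 8 * e * a * b * (a ^+ 2 + b ^+ 2) ^+ 2 * lambda * B (r t)
      + 4 * d * (2 * kappa * a * b + lambda * (b ^+ 2 + e * a ^+ 2)) ^+ 2)
      / ((a ^+ 2 + b ^+ 2) ^+ 2 * (b ^+ 2 - e * a ^+ 2) ^+ 2 * A (r t) * B (r t)).
    rewrite -expr2; apply: complexI; have := hreq _ It; rewrite /= epsE deltaE => h.
    by rewrite real_complex_expr h !real_complexE.
  by field; rewrite An Bn n0 D0.
have UI : U `<=` phase a b @^-1` I by move=> p [].
have oU : open U by apply: openI hM _; exact: open_phase_preimage.
split.
- split=> k.
    apply: (Ck_congr oU) (Ck_affine_plus_wave k 0 0 0 1 oU UI hr) => p Up.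
    by rewrite !mul0r !add0r mul1r.
  apply: (Ck_congr oU) (Ck_affine_plus_wave k a b 0 1 oU UI hH) => p Up.
  by rewrite addr0 mul1r.
- by move=> p [_]; exact: hrJ.
- apply: (travelling_wave_critical epsVE deltaE hJ hA hB hr hH hrJ UI).
  + by move=> t It; exact: (profile_S_equation n0 hI hB hr hH hrJ H1_eq It).
  + by move=> t It; exact: (profile_R_equation he hd D0 n0 hI hA hB B0 hr hrJ r0 H1_eq r1_eq It).
Qed.
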